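(* For any non-zero polynomial $g(T)\in\mathbb{Z}[T]$ with non-negative coefficients, there exists a nilpotent $\mathbb{Z}$-Lie algebra $\mathfrak{g}$ which is finitely generated as an abelian group such that $$m_{\mathrm{faithful}}(\exp(\mathfrak g\otimes_{\mathbb Z}\mathbb F_q))=f\,g(q),\qquad q=p^f,$$ for every prime $p\ge\deg g(T)+2$ and every integer $f\ge1$.
   Context: For a finite group $G$, $m_{\mathrm{faithful}}(G)$ denotes the smallest dimension of a faithful complex representation of $G$. For a finite $\mathbb{Z}$-Lie algebra $L$ of $p$-power order, nilpotent of class less than $p$, $\exp(L)$ is the group with underlying set $L$ and multiplication given by the Baker–Campbell–Hausdorff formula $x*y=x+y+\frac12[x,y]+\cdots$ (Lazard correspondence). *)

(* Defs.v *)
From HB Require Import structures.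
From mathcomp Require Import all_boot all_order all_algebra all_fingroup.
From mathcomp Require Import ring_quotient generic_quotient pgroup mxrepresentation.
From mathcomp Require Import freeg complex.
From mathcomp Require Import boolp classical_sets reals.

Set Implicit Arguments.
Unset Strict Implicit.
Unset Printing Implicit Defensive.

Import Order.TTheory GRing.Theory Num.Theory.
Local Open Scope ring_scope.
Local Open Scope quotient_scope.

Inductive addspan (M : zmodType) (S : M -> Prop) : M -> Prop :=
| addspan_in x of S x : addspan S x
| addspan0 : addspan S 0
| addspanB x y of addspan S x & addspan S y : addspan S (x - y).

Definition fg_zmod (M : zmodType) : Prop :=
  exists s : seq M, forall x, addspan (fun y => y \in s) x.

HB.mixin Record Zmodule_isLie L of GRing.Zmodule L := {
  lie : L -> L -> L;
  lieDl : forall x y z : L, lie (x + y) z = lie x z + lie y z;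
  lieDr : forall x y z : L, lie z (x + y) = lie z x + lie z y;
  liexx : forall x : L, lie x x = 0;
  lie_jacobi : forall x y z : L,
    lie x (lie y z) + lie y (lie z x) + lie z (lie x y) = 0
}.

#[short(type="lieType")]
HB.structure Definition Lie := { L of Zmodule_isLie L & GRing.Zmodule L }.

(* Indexing starts at 0: [lcs 0] is L and [lcs n] is the (n+1)-st term of the
   lower central series, so that [lcs c = 0] says that the class is <= c. *)
Fixpoint lcs (L : lieType) (n : nat) : L -> Prop :=
  if n is n'.+1 then
    addspan (fun z => exists x y : L, lcs n' y /\ z = lie x y)
  else fun=> True.

Definition lie_class_le (L : lieType) (c : nat) : Prop :=
  forall x : L, lcs c x -> x = 0.

Definition lie_nilpotent (L : lieType) : Prop := exists c, lie_class_le L c.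

Section Tensor.
Variables U V : zmodType.
Local Notation fg := {freeg (U * V) / int}.

Inductive tensor_rel : fg -> Prop :=
| TensorDl x y a : tensor_rel (<< (x + y, a) >> - << (x, a) >> - << (y, a) >>)
| TensorDr x a b : tensor_rel (<< (x, a + b) >> - << (x, a) >> - << (x, b) >>).

Definition tensor_ker : {pred fg} := [pred D | `[< addspan tensor_rel D >]].

Lemma tensor_ker_zmod : zmod_closed tensor_ker.
Proof.
split; first by apply/asboolP; exact: addspan0.
by move=> D E /asboolP DP /asboolP EP; apply/asboolP; exact: addspanB.
Qed.

HB.instance Definition _ := GRing.isZmodClosed.Build fg tensor_ker tensor_ker_zmod.

Definition tensor := Quotient.quot tensor_ker.
HB.instance Definition _ := GRing.Zmodule.on tensor.
HB.instance Definition _ := EqQuotient.on tensor.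

Definition tens (x : U) (a : V) : tensor := \pi_tensor << (x, a) >>.

Lemma tensDl x y a : tens (x + y) a = tens x a + tens y a.
Proof.
apply/eqP; rewrite /tens -raddfD /= -Quotient.idealrBE opprD addrA.
by apply/asboolP; apply: addspan_in; exact: TensorDl.
Qed.

Lemma tensDr x a b : tens x (a + b) = tens x a + tens x b.
Proof.
apply/eqP; rewrite /tens -raddfD /= -Quotient.idealrBE opprD addrA.
by apply/asboolP; apply: addspan_in; exact: TensorDr.
Qed.

Lemma tensor_ind (P : tensor -> Prop) :
  (forall x a, P (tens x a)) -> (forall t u, P t -> P u -> P (t - u)) ->
  forall t, P t.
Proof.
move=> Pt PB; elim/quotW=> D.
have P0 : P 0 by rewrite -(subrr (tens 0 0)); apply: PB.
have PN t : P t -> P (- t) by rewrite -sub0r; apply: PB.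
have PD t u : P t -> P u -> P (t + u).
  by move=> ht hu; rewrite -[u]opprK; apply: PB => //; exact: PN.
have PM t n : P t -> P (t *+ n).
  by move=> ht; elim: n => [|n IH]; rewrite ?mulr0n // mulrS; apply: PD.
rewrite -(freeg_sumE D) raddf_sum; elim/big_ind: _ => // -[x a] _.
have -> k : << k *g (x, a) >> = << (x, a) >> *~ k :> fg.
  by rewrite freegU_mulz intz.
rewrite raddfMz; case: (coeff _ _) => n; first by rewrite -pmulrn; apply: PM; apply: Pt.
by rewrite NegzE mulrNz -pmulrn; apply/PN/PM/Pt.
Qed.

Section Lift.
Variables (M : zmodType) (h : U -> V -> M).

Definition tensor_lift (t : tensor) : M :=
  fglift (fun u => h u.1 u.2 : zmodule M) (repr t).

Hypothesis hDl : forall a, {morph h^~ a : x y / x + y}.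
Hypothesis hDr : forall x, {morph h x : a b / a + b}.

Lemma tensor_lift_pi (D : fg) :
  tensor_lift (\pi_tensor D) = fglift (fun u => h u.1 u.2 : zmodule M) D.
Proof.
have fB := @lift_is_additive _ _ (zmodule M) (fun u => h u.1 u.2 : zmodule M).
have K E : E \in tensor_ker -> fglift (fun u => h u.1 u.2 : zmodule M) E = 0.
  move/asboolP; elim=> {E} [E [x y a|x a b]||D1 D2 _ e1 _ e2].
  - by rewrite !fB !liftU !scale1r /= hDl addrAC addrK subrr.
  - by rewrite !fB !liftU !scale1r /= hDr addrAC addrK subrr.
  - by rewrite -(subrr 0) fB subrr.
  - by rewrite fB e1 e2 subrr.
apply/eqP; rewrite -subr_eq0 -fB; apply/eqP/K.
by rewrite Quotient.idealrBE reprK.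
Qed.

Lemma tensor_liftE x a : tensor_lift (tens x a) = h x a.
Proof. by rewrite tensor_lift_pi liftU scale1r. Qed.

Lemma tensor_liftB : {morph tensor_lift : t u / t - u}.
Proof.
move=> t u; rewrite -[t]reprK -[u]reprK -raddfB /= !tensor_lift_pi.
exact: (@lift_is_additive _ _ (zmodule M)).
Qed.

End Lift.
End Tensor.

Section TensorLie.
Variables (L : lieType) (A : comNzRingType).
Local Notation LA := (tensor L A).

(* [x (X) a, y (X) b] = [x, y] (X) ab, extended biadditively. *)
Definition tensor_lie (t u : LA) : LA :=
  tensor_lift (fun x a => tensor_lift (fun y b => tens (lie x y) (a * b)) u) t.

Let hDl (x : L) (a b : A) : {morph (fun y => tens (lie x y) (a * b)) : y z / y + z}.
Proof. by move=> y z; rewrite lieDr tensDl. Qed.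
Let hDr (x : L) (a : A) (y : L) : {morph (fun b => tens (lie x y) (a * b)) : b c / b + c}.
Proof. by move=> b c; rewrite mulrDr tensDr. Qed.

Lemma tensor_lie_tensl (x : L) (a : A) (u : LA) :
  tensor_lie (tens x a) u = tensor_lift (fun y b => tens (lie x y) (a * b)) u.
Proof.
have liftB x' a' := tensor_liftB (hDl x' a') (hDr x' a').
have liftE x' a' := tensor_liftE (hDl x' a') (hDr x' a').
apply: tensor_liftE => [b y z|y b c].
- elim/tensor_ind: u => [w d|u v IHu IHv]; first by rewrite !liftE lieDl tensDl.
  by rewrite !liftB IHu IHv opprD addrACA.
- elim/tensor_ind: u => [w d|u v IHu IHv]; first by rewrite !liftE mulrDl tensDr.
  by rewrite !liftB IHu IHv opprD addrACA.
Qed.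

Lemma tensor_lieE (x : L) (a : A) (y : L) (b : A) :
  tensor_lie (tens x a) (tens y b) = tens (lie x y) (a * b).
Proof. by rewrite tensor_lie_tensl (tensor_liftE (hDl x a) (hDr x a)). Qed.

Lemma tensor_lieBl (t u v : LA) : tensor_lie (t - u) v = tensor_lie t v - tensor_lie u v.
Proof.
have liftB x' a' := tensor_liftB (hDl x' a') (hDr x' a').
have liftE x' a' := tensor_liftE (hDl x' a') (hDr x' a').
apply: tensor_liftB => [b y z|y b c].
- elim/tensor_ind: v => [w d|v w IHv IHw]; first by rewrite !liftE lieDl tensDl.
  by rewrite !liftB IHv IHw opprD addrACA.
- elim/tensor_ind: v => [w d|v w IHv IHw]; first by rewrite !liftE mulrDl tensDr.
  by rewrite !liftB IHv IHw opprD addrACA.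
Qed.

Lemma tensor_lieBr (t u v : LA) : tensor_lie v (t - u) = tensor_lie v t - tensor_lie v u.
Proof.
elim/tensor_ind: v => [x a|v w IHv IHw].
  by rewrite !tensor_lie_tensl (tensor_liftB (hDl x a) (hDr x a)).
by rewrite !tensor_lieBl IHv IHw !opprB addrACA [RHS]addrACA [- _ + _]addrC.
Qed.

Let lie0l (u : LA) : tensor_lie 0 u = 0.
Proof. by have := tensor_lieBl 0 0 u; rewrite !subrr. Qed.
Let lie0r (u : LA) : tensor_lie u 0 = 0.
Proof. by have := tensor_lieBr 0 0 u; rewrite !subrr. Qed.

Lemma tensor_lieDl (t u v : LA) : tensor_lie (t + u) v = tensor_lie t v + tensor_lie u v.
Proof.
by rewrite -[u in LHS]opprK tensor_lieBl -[- u]sub0r tensor_lieBl lie0l sub0r opprK.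
Qed.

Lemma tensor_lieDr (t u v : LA) : tensor_lie v (t + u) = tensor_lie v t + tensor_lie v u.
Proof.
by rewrite -[u in LHS]opprK tensor_lieBr -[- u]sub0r tensor_lieBr lie0r sub0r opprK.
Qed.

Let lieC (x y : L) : lie x y + lie y x = 0.
Proof. by have := liexx (x + y); rewrite lieDl !lieDr !liexx add0r addr0. Qed.

Let tens0l (a : A) : tens 0 a = 0 :> LA.
Proof. by apply: (addrI (tens 0 a)); rewrite -tensDl !addr0. Qed.

Let tensor_lieC (t u : LA) : tensor_lie t u + tensor_lie u t = 0.
Proof.
elim/tensor_ind: t u => [x a|t v IHt IHv] u.
- elim/tensor_ind: u => [y b|u v IHu IHv].
    by rewrite !tensor_lieE [b * a]mulrC -tensDl lieC tens0l.
  by rewrite tensor_lieBl tensor_lieBr addrACA -opprD IHu IHv subrr.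
- by rewrite tensor_lieBl tensor_lieBr addrACA -opprD IHt IHv subrr.
Qed.

Lemma tensor_liexx (t : LA) : tensor_lie t t = 0.
Proof.
elim/tensor_ind: t => [x a|t u IHt IHu]; first by rewrite tensor_lieE liexx tens0l.
rewrite tensor_lieBl !tensor_lieBr IHt IHu subr0 sub0r -opprD.
by rewrite tensor_lieC oppr0.
Qed.

Lemma tensor_lie_jacobi (t u v : LA) :
  tensor_lie t (tensor_lie u v) + tensor_lie u (tensor_lie v t)
    + tensor_lie v (tensor_lie t u) = 0.
Proof.
have E (a b c d e f : LA) : (a - b) + (c - d) + (e - f) = (a + c + e) - (b + d + f).
  by rewrite (addrACA a) (addrACA (a + c)) -!opprD.
elim/tensor_ind: t u v => [x a|t t' IHt IHt'] u v; last first.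
  by rewrite !(tensor_lieBl, tensor_lieBr) E IHt IHt' subrr.
elim/tensor_ind: u v => [y b|u u' IHu IHu'] v; last first.
  by rewrite !(tensor_lieBl, tensor_lieBr) E IHu IHu' subrr.
elim/tensor_ind: v => [z c|v v' IHv IHv']; last first.
  by rewrite !(tensor_lieBl, tensor_lieBr) E IHv IHv' subrr.
rewrite !tensor_lieE; set abc := a * (b * c).
have -> : b * (c * a) = abc by rewrite /abc mulrA mulrC.
have -> : c * (a * b) = abc by rewrite /abc mulrC mulrA.
by rewrite -!tensDl lie_jacobi tens0l.
Qed.

HB.instance Definition _ := Zmodule_isLie.Build LA
  tensor_lieDl tensor_lieDr tensor_liexx tensor_lie_jacobi.

End TensorLie.

Section BCH.
Variable L : lieType.

(* In a finite L of p-power order, multiplication by a rational number whose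
   denominator is prime to p: the unique y with (denq c) y = (numq c) x. *)
Definition qscale (c : rat) (x : L) : L :=
  xget 0 [set y | y *~ denq c = x *~ numq c].

(* [:: a1; a2; ...; an] |-> [a1, [a2, [..., an]]] *)
Fixpoint lie_word (w : seq L) : L :=
  match w with
  | [::] => 0
  | [:: a] => a
  | a :: w' => lie a (lie_word w')
  end.

(* Dynkin's form of the formula. The coefficient of the bracket of the word
   x^{r_1} y^{s_1} ... x^{r_k} y^{s_k} of length n is
   (-1)^{k-1} / (k n r_1! s_1! ... r_k! s_k!), where (r_i, s_i) = m i is nonzero.
   In nilpotency class < p only the terms of degree n < p survive, and their
   coefficients have denominator prime to p. *)
Definition dynkin_coef (n k : nat) (m : {ffun 'I_k -> 'I_n.+1 * 'I_n.+1}) : rat :=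
  (-1) ^+ k.-1 / (k * n * \prod_(i < k) ((m i).1`! * (m i).2`!))%N%:R.

Definition dynkin_word (n k : nat) (m : {ffun 'I_k -> 'I_n.+1 * 'I_n.+1})
    (x y : L) : seq L :=
  flatten [seq nseq (m i).1 x ++ nseq (m i).2 y | i <- enum 'I_k].

Definition bch (p : nat) (x y : L) : L :=
  \sum_(1 <= n < p) \sum_(1 <= k < n.+1)
    \sum_(m : {ffun 'I_k -> 'I_n.+1 * 'I_n.+1}
          | [forall i, 0 < (m i).1 + (m i).2]%N &&
            (\sum_(i < k) ((m i).1 + (m i).2) == n)%N)
      qscale (dynkin_coef m) (lie_word (dynkin_word m x y)).

(* The group gT is exp(L), for L of p-power order and nilpotent of class < p:
   phi identifies the underlying set of gT with that of L. *)
Definition is_exp (p : nat) (gT : finGroupType) : Prop :=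
  [/\ (p.-group [set: gT])%g, lie_class_le L p.-1 &
      exists phi : L -> gT, bijective phi /\
        forall x y, phi (bch p x y) = (phi x * phi y)%g].

End BCH.

Section FaithfulDimension.
Variables (R : realType) (gT : finGroupType) (G : {group gT}).

Definition has_faithful_repr (n : nat) : bool :=
  `[< exists rG : mx_representation R[i] G n, mx_faithful rG >].

Lemma has_faithful_reprW : exists n, has_faithful_repr n.
Proof.
exists #|G|; apply/asboolP; exists (regular_repr R[i] G).
exact: regular_mx_faithful.
Qed.

Definition m_faithful : nat := ex_minn has_faithful_reprW.

End FaithfulDimension.

(* Main.v *)
(* Take for L a direct sum, over the monomials T^d of g with multiplicity, of
   integral Heisenberg Lie algebras of rank 2 d + 1. Over F = F_q its exponential
   is the group G of triples (x, y, z) with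
   (x, y, z)(x', y', z') = (x + x', y + y', z + z' + <x, y'>), where z has one
   coordinate for every summand.

   Upper bound: the sum over the summands j and over f independent additive
   characters of F of the Schroedinger representations, on functions of
   s in F^{d_j}, is faithful.

   Lower bound: diagonalise a faithful representation on the elementary abelian
   normal subgroup {x = 0}, and write the weights as F_p-linear forms. Faithfulness
   makes the restrictions of the weights to the centre, written in an F_p-basis
   indexed by the pairs (j, k) with k < f, a matrix of full column rank. A nonzero
   term of a maximal minor gives weights that are pairwise distinct on the centre,
   the one attached to (j, k) being nontrivial on the j-th coordinate; conjugating
   it by the x in F^{d_j} produces q^{d_j} distinct weights with the same
   restriction to the centre. *)
From HB Require Import structures.
Require Import Defs.
From mathcomp Require Import all_boot all_order all_algebra all_fingroup.
From mathcomp Require Import pgroup finfield mxrepresentation.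
From mathcomp Require Import boolp complex.
From mathcomp Require classical_sets.
From mathcomp Require Import reals.

Set Implicit Arguments.
Unset Strict Implicit.
Unset Printing Implicit Defensive.

Import Order.TTheory GRing.Theory Num.Theory.
Local Open Scope ring_scope.

(** * Heisenberg Lie rings and groups *)

Section Cocycle.
Variables (I J : finType) (t : I -> J).

(* Coordinates x_i and y_i (i : I) and z_j (j : J); the pairs (x_i, y_i) with
   [t i = j] span, together with z_j, the j-th Heisenberg summand. *)
Definition hidx : finType := (I + I + J)%type.
Definition xc (i : I) : hidx := inl (inl i).
Definition yc (i : I) : hidx := inl (inr i).
Definition zc (j : J) : hidx := inr j.

(** The fibrewise pairing of x-coordinates with y-coordinates, with values in the z-coordinates.
    Antisymmetrised it is the Lie bracket; as it stands it is the group cocycle. *)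
Definition beta (A : comNzRingType) (u v : {ffun hidx -> A}) : {ffun hidx -> A} :=
  [ffun k => if k is inr j then \sum_(i | t i == j) u (xc i) * v (yc i) else 0].

Section Ring.
Variable A : comNzRingType.
Implicit Types u v w : {ffun hidx -> A}.

Lemma beta_x u v i : beta u v (xc i) = 0. Proof. by rewrite ffunE. Qed.
Lemma beta_y u v i : beta u v (yc i) = 0. Proof. by rewrite ffunE. Qed.

Lemma betaDl u v w : beta (u + v) w = beta u w + beta v w.
Proof.
apply/ffunP => -[[i|i]|j]; rewrite !ffunE ?addr0 //.
by rewrite -big_split; apply: eq_bigr => i _; rewrite ffunE mulrDl.
Qed.

Lemma betaDr u v w : beta w (u + v) = beta w u + beta w v.
Proof.
apply/ffunP => -[[i|i]|j]; rewrite !ffunE ?addr0 //.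
by rewrite -big_split; apply: eq_bigr => i _; rewrite ffunE mulrDr.
Qed.

Lemma beta0l u : beta 0 u = 0.
Proof. by apply: (addrI (beta 0 u)); rewrite -betaDl !addr0. Qed.
Lemma beta0r u : beta u 0 = 0.
Proof. by apply: (addrI (beta u 0)); rewrite -betaDr !addr0. Qed.
Lemma betaNl u v : beta (- u) v = - beta u v.
Proof. by apply/eqP; rewrite -addr_eq0 -betaDl addNr beta0l. Qed.
Lemma betaNr u v : beta u (- v) = - beta u v.
Proof. by apply/eqP; rewrite -addr_eq0 -betaDr addNr beta0r. Qed.

(** Values of [beta] have only z-coordinates, which [beta] does not read. This yields class two for
    the Lie ring and associativity for the group. *)
Lemma beta_betal u v w : beta (beta u v) w = 0.
Proof.
apply/ffunP => -[[i|i]|j]; rewrite !ffunE //.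
by rewrite big1 // => i _; rewrite beta_x mul0r.
Qed.
Lemma beta_betar u v w : beta u (beta v w) = 0.
Proof.
apply/ffunP => -[[i|i]|j]; rewrite !ffunE //.
by rewrite big1 // => i _; rewrite beta_y mulr0.
Qed.

Lemma betaMnl u v n : beta (u *+ n) v = beta u v *+ n.
Proof.
by elim: n => [|n IH]; rewrite ?mulr0n ?beta0l // !mulrS betaDl IH.
Qed.
Lemma betaMnr u v n : beta u (v *+ n) = beta u v *+ n.
Proof.
by elim: n => [|n IH]; rewrite ?mulr0n ?beta0r // !mulrS betaDr IH.
Qed.

End Ring.
End Cocycle.

Section HeisenbergLie.
Variables (I J : finType) (t : I -> J).

(* The phantom argument lets [t] determine the bracket. *)
Definition heis_lie (_ : I -> J) : Type := {ffun hidx I J -> int}.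
HB.instance Definition _ := GRing.Zmodule.on (heis_lie t).

Definition hbracket (u v : heis_lie t) : heis_lie t := beta t u v - beta t v u.

Let bracketDl u v w : hbracket (u + v) w = hbracket u w + hbracket v w.
Proof. by rewrite /hbracket betaDl betaDr opprD addrACA. Qed.
Let bracketDr u v w : hbracket w (u + v) = hbracket w u + hbracket w v.
Proof. by rewrite /hbracket betaDl betaDr opprD addrACA. Qed.
Let bracketxx u : hbracket u u = 0.
Proof. exact: subrr. Qed.

Lemma hbracket3 u v w : hbracket u (hbracket v w) = 0.
Proof.
by rewrite /hbracket betaDl betaDr betaNl betaNr !beta_betal !beta_betar !subr0.
Qed.

Let bracket_jacobi u v w : hbracket u (hbracket v w) + hbracket v (hbracket w u)
  + hbracket w (hbracket u v) = 0.
Proof. by rewrite !hbracket3 !addr0. Qed.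

HB.instance Definition _ := Zmodule_isLie.Build (heis_lie t)
  bracketDl bracketDr bracketxx bracket_jacobi.

End HeisenbergLie.

Section HeisenbergGroup.
Variables (I J : finType) (t : I -> J) (F : finFieldType).

Definition heis_group (_ : I -> J) : Type := {ffun hidx I J -> F}.
HB.instance Definition _ := Finite.on (heis_group t).

(** The polarised group law: without the factor 1/2 of the series it makes sense in characteristic 2
    as well. *)
Definition heis_mul (u v : heis_group t) : heis_group t :=
  ((u : {ffun hidx I J -> F}) + v + beta t u v)%R.
Definition heis_inv (u : heis_group t) : heis_group t :=
  (- (u : {ffun hidx I J -> F}) + beta t u u)%R.

Let mulA : associative heis_mul.
Proof.
move=> u v w; rewrite /heis_mul !betaDl !betaDr beta_betal beta_betar !addr0.
by rewrite !addrA [LHS](ACl (1*2*5*3*6*4)).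
Qed.
Let mul1 : left_id (0 : {ffun hidx I J -> F}) heis_mul.
Proof. by move=> u; rewrite /heis_mul beta0l addr0 add0r. Qed.
Let mulr1 : right_id (0 : {ffun hidx I J -> F}) heis_mul.
Proof. by move=> u; rewrite /heis_mul beta0r !addr0. Qed.
Let mulV : left_inverse (0 : {ffun hidx I J -> F}) heis_inv heis_mul.
Proof.
move=> u; rewrite /heis_mul /heis_inv betaDl betaNl beta_betal addr0.
by rewrite (addrC (- _)) addrNK subrr.
Qed.
Let mulrV : right_inverse (0 : {ffun hidx I J -> F}) heis_inv heis_mul.
Proof.
move=> u; rewrite /heis_mul /heis_inv betaDr betaNr beta_betar addr0.
by rewrite addrA subrr add0r subrr.
Qed.

HB.instance Definition _ := isGroup.Build (heis_group t) mulA mul1 mulr1 mulV mulrV.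
HB.instance Definition _ := FinGroup.on (heis_group t).

Lemma heis_mulE (u v : heis_group t) : (u * v)%g = heis_mul u v.
Proof. by []. Qed.

End HeisenbergGroup.

(** * The Baker-Campbell-Hausdorff series in class two *)

(** [xget] returns some solution, or 0 if there is none; injectivity of multiplication by the
    denominator makes y the only one. *)
Lemma qscaleE (L : lieType) (c : rat) (x y : L) :
  injective (fun z : L => z *~ denq c) -> y *~ denq c = x *~ numq c ->
  qscale c x = y.
Proof.
move=> inj yE; apply: classical_sets.xget_unique => //= z zE.
by apply: inj; rewrite yE.
Qed.

Lemma sum_ffun1 (T : finType) (M : nmodType) (G : {ffun 'I_1 -> T} -> M)
    (P : pred {ffun 'I_1 -> T}) :
  \sum_(m | P m) G m = \sum_(a | P [ffun=> a]) G [ffun=> a].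
Proof.
apply: (reindex (fun a : T => [ffun _ : 'I_1 => a])).
exists (fun m : {ffun 'I_1 -> T} => m ord0) => [a _|m _]; first by rewrite ffunE.
by apply/ffunP => i; rewrite ffunE (ord1 i); congr (m _); apply: val_inj.
Qed.

Definition ffun_pair (T : finType) (a b : T) : {ffun 'I_2 -> T} :=
  [ffun i => if i == ord0 then a else b].

Lemma sum_ffun2 (T : finType) (M : nmodType) (G : {ffun 'I_2 -> T} -> M)
    (P : pred {ffun 'I_2 -> T}) :
  \sum_(m | P m) G m =
  \sum_(ab : T * T | P (ffun_pair ab.1 ab.2)) G (ffun_pair ab.1 ab.2).
Proof.
apply: (reindex (fun ab : T * T => ffun_pair ab.1 ab.2)).
exists (fun m : {ffun 'I_2 -> T} => (m ord0, m ord_max)) => [[a b] _|m _].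
  by rewrite /ffun_pair !ffunE.
apply/ffunP => i; rewrite ffunE; have [->//|] := eqVneq i ord0.
by case: i => [[|[]]] //= *; congr (m _); apply: val_inj.
Qed.

(** Stated for all n because a block of weight 1 occurs in degree 1, with entries in ['I_2], and
    twice in degree 2, with entries in ['I_3]. *)
Lemma sum_weight1 n (M : nmodType) (G : 'I_n.+2 * 'I_n.+2 -> M) :
  \sum_(a : 'I_n.+2 * 'I_n.+2 | (a.1 + a.2 == 1)%N) G a =
  G (inord 1, ord0) + G (ord0, inord 1).
Proof.
rewrite (bigD1 (inord 1, ord0)) /= ?inordK //; congr (_ + _).
rewrite (bigD1 (ord0, inord 1)) /= ?inordK //; last first.
  by rewrite xpair_eqE negb_and -val_eqE /= inordK.
rewrite big_pred0 ?addr0 // => -[[[|[|a]] ha] [[|[|b]] hb]] //=.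
  by rewrite !xpair_eqE -!val_eqE /= !inordK //= andbF.
by rewrite !xpair_eqE -!val_eqE /= !inordK.
Qed.

Lemma sum_weight2 (M : nmodType) (G : 'I_3 * 'I_3 -> M) :
  \sum_(a : 'I_3 * 'I_3 | (a.1 + a.2 == 2)%N) G a =
  G (inord 2, ord0) + G (inord 1, inord 1) + G (ord0, inord 2).
Proof.
rewrite (bigD1 (inord 2, ord0)) /= ?inordK // -addrA; congr (_ + _).
rewrite (bigD1 (inord 1, inord 1)) /= ?inordK //; last first.
  by rewrite xpair_eqE negb_and -val_eqE /= !inordK.
congr (_ + _).
rewrite (bigD1 (ord0, inord 2)) /= ?inordK //; last first.
  by rewrite !xpair_eqE !negb_and -!val_eqE /= !inordK.
rewrite big_pred0 ?addr0 // => -[[[|[|[|a]]] ha] [[|[|[|b]]] hb]] //=;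
by rewrite !xpair_eqE -!val_eqE /= !inordK //= ?andbF.
Qed.

Lemma weight_ffun1 n (a : 'I_n.+2 * 'I_n.+2) :
  [forall i, (0 < ([ffun _ : 'I_1 => a] i).1 + ([ffun _ : 'I_1 => a] i).2)%N] &&
  ((\sum_(i < 1) (([ffun _ : 'I_1 => a] i).1 + ([ffun _ : 'I_1 => a] i).2))%N == n.+1)
  = (a.1 + a.2 == n.+1)%N.
Proof.
rewrite big_ord1 ffunE andbC; case: eqP => //= an; apply/forallP => i.
by rewrite ffunE an.
Qed.

Lemma dynkin_word1 (L : lieType) n (a : 'I_n.+1 * 'I_n.+1) (x y : L) :
  dynkin_word [ffun _ : 'I_1 => a] x y = nseq a.1 x ++ nseq a.2 y.
Proof. by rewrite /dynkin_word enum_ordSl enum_ord0 /= ffunE cats0. Qed.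

Lemma dynkin_word2 (L : lieType) n (a b : 'I_n.+1 * 'I_n.+1) (x y : L) :
  dynkin_word (ffun_pair a b) x y =
  nseq a.1 x ++ nseq a.2 y ++ nseq b.1 x ++ nseq b.2 y.
Proof.
by rewrite /dynkin_word !enum_ordSl enum_ord0 /= !ffunE /= cats0 -!catA.
Qed.

Lemma dynkin_coef1 n (a : 'I_n.+1 * 'I_n.+1) :
  dynkin_coef [ffun _ : 'I_1 => a] = (n * (a.1`! * a.2`!))%N%:R^-1.
Proof. by rewrite /dynkin_coef big_ord1 ffunE mul1n expr0 mul1r. Qed.

Lemma dynkin_coef2 n (a b : 'I_n.+1 * 'I_n.+1) :
  dynkin_coef (ffun_pair a b) =
  - (2 * n * (a.1`! * a.2`! * (b.1`! * b.2`!)))%N%:R^-1.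
Proof.
by rewrite /dynkin_coef big_ord_recl big_ord1 !ffunE /= expr1 mulN1r.
Qed.

(** The reduced denominator divides every D for which c D is an integer, so it inherits coprimality
    to p from D. *)
Lemma coprime_denq (p : nat) (c : rat) (s : int) (D : nat) :
  coprime p D -> c * D%:R = s%:~R -> coprime p `|denq c|.
Proof.
move=> pD cD; apply: coprime_dvdr pD.
have : (denq c %| D%:Z * numq c)%Z.
  apply/dvdzP; exists s; apply: (@intr_inj rat).
  by rewrite !intrM -cD numqE -pmulrn mulrCA mulrA.
by rewrite Gauss_dvdzl // coprimezE coprime_sym coprime_num_den.
Qed.

Section QScaleTorsion.
Variables (p : nat) (L : lieType).
Hypothesis pL : forall z : L, z *+ p = 0.

(** A Bezout relation between p and d inverts multiplication by d, since p kills L. *)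
Lemma mulrz_inj_torsion (d : int) :
  coprime p `|d| -> injective (fun z : L => z *~ d).
Proof.
move=> pd z w /= zw; apply/eqP; rewrite -subr_eq0; apply/eqP.
have: (z - w) *~ d = 0 by rewrite mulrzBl zw subrr.
have: coprimez p d by [].
case/coprimezP => -[u v] /= uv e.
rewrite -[z - w]mulr1z -uv mulrzDr (mulrC v) !mulrzA e mulrzAC -pmulrn pL.
by rewrite !mul0rz addr0.
Qed.

(** Allows c to be given as an unreduced fraction s / D, so that [numq c] and [denq c] are never
    computed. *)
Lemma qscale_torsion (c : rat) (s : int) (D : nat) (x y : L) :
  coprime p D -> c * D%:R = s%:~R -> y *+ D = x *~ s -> qscale c x = y.
Proof.
move=> pD cD yD; apply: qscaleE.
  by apply: mulrz_inj_torsion; apply: coprime_denq cD.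
apply: (@mulrz_inj_torsion D) => //=.
rewrite -!mulrzA (mulrC (denq c)) [LHS]mulrzA -pmulrn yD -mulrzA; congr (_ *~ _).
by apply: (@intr_inj rat); rewrite !intrM -cD numqE -pmulrn mulrAC.
Qed.
End QScaleTorsion.

Section BCHClass2.
Variable L : lieType.
Hypothesis lie3 : forall x y z : L, lie x (lie y z) = 0.

Lemma lie_word3 (w : seq L) : (2 < size w)%N -> lie_word w = 0.
Proof. by case: w => [|a [|b [|c w]]] //= _; rewrite lie3. Qed.

Lemma size_dynkin_word n k (m : {ffun 'I_k -> 'I_n.+1 * 'I_n.+1}) (x y : L) :
  size (dynkin_word m x y) = (\sum_(i < k) ((m i).1 + (m i).2))%N.
Proof.
rewrite size_flatten /shape -map_comp sumnE big_map big_enum /=.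
by apply: eq_bigr => i _; rewrite size_cat !size_nseq.
Qed.

(** With indexing from 0, [lcs 2] is spanned by brackets [a, b] with b in the span of brackets, so
    additivity reduces it to triple brackets. *)
Lemma lcs_class2 n (x : L) : lcs n.+2 x -> x = 0.
Proof.
elim: n x => [|n IH] x.
  elim=> {x} [x [a [b [hb ->]]]|//|x y _ -> _ ->]; last by rewrite subrr.
  elim: hb => {b} [b [c [d [_ ->]]]||b c _ e1 _ e2]; first exact: lie3.
    by apply: (addrI (lie a 0)); rewrite -lieDr !addr0.
  by have := lieDr (b - c) c a; rewrite subrK e1 e2 addr0.
elim=> {x} [x [a [b [/IH-> ->]]]|//|x y _ -> _ ->]; last by rewrite subrr.
by apply: (addrI (lie a 0)); rewrite -lieDr !addr0.
Qed.

Variable p : nat.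
Hypothesis p_prime : prime p.
Hypothesis pL : forall z : L, z *+ p = 0.

Lemma coprime_fact n : (n < p)%N -> coprime p n`!.
Proof.
elim: n => [|n IH] np; first by rewrite fact0 coprimen1.
by rewrite factS coprimeMr IH ?(ltnW np) // andbT prime_coprime // gtnNdvd.
Qed.

(** Were p to divide the denominator, [qscale] of 0 could be any torsion element. Here every factor
    of k n r_1! s_1! ... is at most n or the factorial of such a number, and n < p. *)
Lemma qscale_dynkin0 n k (m : {ffun 'I_k -> 'I_n.+1 * 'I_n.+1}) :
  (0 < n < p)%N -> (0 < k <= n)%N -> qscale (dynkin_coef m) (0 : L) = 0.
Proof.
move=> /andP[n0 np] /andP[k0 kn].
have co q : (0 < q < p)%N -> coprime p q.
  by move=> /andP[q0 qp]; rewrite prime_coprime // gtnNdvd.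
apply: (@qscale_torsion p _ pL _ ((-1) ^+ k.-1)
  (k * n * \prod_(i < k) ((m i).1`! * (m i).2`!))%N); last by rewrite mul0rn mul0rz.
  rewrite !coprimeMr co ?k0 ?(leq_ltn_trans kn) // co ?n0 //=.
  elim/big_ind: _ => [|a b|i _]; rewrite ?coprimen1 //.
    by rewrite coprimeMr => -> ->.
  by rewrite coprimeMr !coprime_fact // (leq_ltn_trans _ np) // -ltnS ltn_ord.
rewrite /dynkin_coef divfK ?rmorphXn ?rmorphN1 // pnatr_eq0 -lt0n !muln_gt0 k0 n0 /=.
by rewrite prodn_gt0 // => i; rewrite muln_gt0 !fact_gt0.
Qed.

Lemma dynkin_sum1 (x y : L) :
  \sum_(1 <= k < 2)
    \sum_(m : {ffun 'I_k -> 'I_2 * 'I_2}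
          | [forall i, 0 < (m i).1 + (m i).2]%N &&
            (\sum_(i < k) ((m i).1 + (m i).2) == 1)%N)
      qscale (dynkin_coef m) (lie_word (dynkin_word m x y)) = x + y.
Proof.
rewrite big_nat1 sum_ffun1 (eq_bigl _ _ (@weight_ffun1 0)) sum_weight1.
rewrite !dynkin_word1 /= !inordK //=.
have q1 (c : rat) (z : L) : c = 1%N%:R^-1 -> qscale c z = z.
  by move=> ->; apply: (@qscale_torsion p _ pL _ 1 1) => //; rewrite ?coprimen1.
by rewrite !q1 // dynkin_coef1 /= !inordK.
Qed.

(** In degree 2 the single block xy contributes [x, y] / 2, while the two-block words xy and yx
    contribute -[x, y] / 4 and -[y, x] / 4, which cancel. For odd p, [uphalf p] is the inverse of 2
    modulo p. *)
Lemma bch_class2 (x y : L) : (2 < p)%N ->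
  bch p x y = x + y + lie x y *+ uphalf p.
Proof.
move=> p2; rewrite /bch big_ltn ?(ltnW p2) // big_ltn //.
(* From degree 3 on, every word has a vanishing bracket. *)
rewrite [X in _ + (_ + X)]big1_seq ?addr0; last first.
  move=> n /andP[_]; rewrite mem_index_iota => /andP[n3 np].
  rewrite big1_seq // => k /andP[_]; rewrite mem_index_iota ltnS => kn.
  rewrite big1 // => m /andP[_ /eqP mn].
  by rewrite lie_word3 ?size_dynkin_word ?mn // qscale_dynkin0 // np (leq_trans _ n3).
(* Two nonempty blocks of total length 2 have length 1 each. *)
have w2 n (ab : ('I_n * 'I_n) * ('I_n * 'I_n)) :
    [forall i, (0 < (ffun_pair ab.1 ab.2 i).1 + (ffun_pair ab.1 ab.2 i).2)%N] &&
    ((\sum_(i < 2) ((ffun_pair ab.1 ab.2 i).1 + (ffun_pair ab.1 ab.2 i).2))%N == 2)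
    = ((ab.1.1 + ab.1.2 == 1)%N && (ab.2.1 + ab.2.2 == 1)%N).
  rewrite big_ord_recl big_ord1 !ffunE /=; apply/andP/andP.
    case=> /forallP h; move: (h ord0) (h ord_max); rewrite !ffunE /=.
    move: (ab.1.1 + ab.1.2)%N (ab.2.1 + ab.2.2)%N => [|[|?]] [|[|?]];
    by rewrite ?addSn ?addnS.
  case=> /eqP e1 /eqP e2; rewrite e1 e2; split=> //; apply/forallP => i.
  by rewrite ffunE; case: ifP; rewrite ?e1 ?e2.
rewrite dynkin_sum1 big_ltn // big_nat1 sum_ffun1 sum_ffun2.
rewrite (eq_bigl _ _ (@weight_ffun1 1)) (eq_bigl _ _ (@w2 _)).
rewrite -(pair_big (fun a : 'I_3 * 'I_3 => (a.1 + a.2 == 1)%N)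
  (fun b : 'I_3 * 'I_3 => (b.1 + b.2 == 1)%N) (fun a b =>
    qscale (dynkin_coef (ffun_pair a b))
      (lie_word (dynkin_word (ffun_pair a b) x y)))) /=.
rewrite !sum_weight1 sum_weight2 !dynkin_word1 !dynkin_word2 /= !inordK //=.
rewrite !liexx !qscale_dynkin0 // ?(ltnW p2) // addr0 add0r addr0 add0r.
have podd : odd p by case: (even_prime p_prime) p2 => [->|].
have co2 : coprime p 2 by rewrite coprime_sym prime_coprime // dvdn2 podd.
have halfK (z : L) : z *+ uphalf p *+ 2 = z.
  by rewrite -mulrnA muln2 uphalfK podd mulrSr pL add0r.
have lieC : lie y x = - lie x y.
  apply/eqP; rewrite -addr_eq0; have := liexx (y + x).
  by rewrite lieDl !lieDr !liexx add0r addr0 => ->.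
have q2 (c : rat) (z : L) : c = 2%N%:R^-1 -> qscale c z = z *+ uphalf p.
  move=> ->; apply: (@qscale_torsion p _ pL _ 1 2); rewrite ?mulVf //.
have q4 (c : rat) (z : L) : c = - 4%N%:R^-1 ->
    qscale c z = - (z *+ uphalf p *+ uphalf p).
  move=> ->; apply: (@qscale_torsion p _ pL _ (-1) 4).
  - by rewrite (coprimeMr _ 2 2) co2.
  - by rewrite mulNr mulVf.
  - by rewrite mulNrn (mulrnA _ 2 2) !halfK mulrN1z.
rewrite q2 ?dynkin_coef1 /= ?inordK // !q4 ?dynkin_coef2 /= ?inordK //.
by rewrite lieC !mulNrn opprK addNr addr0.
Qed.
End BCHClass2.

(** * Heisenberg groups as exponentials *)

Section TensorCoordinates.
Variables (I J : finType) (t : I -> J) (A : comNzRingType).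
Local Notation K := (hidx I J).
Local Notation L := (heis_lie t).
Local Notation LA := (tensor L A).

Definition tcoord_pure (u : L) (a : A) : {ffun K -> A} :=
  [ffun k => a *~ (u : {ffun K -> int}) k].

Lemma tcoord_pureDl a : {morph tcoord_pure^~ a : u v / u + v}.
Proof. by move=> u v; apply/ffunP => k; rewrite !ffunE mulrzDr. Qed.
Lemma tcoord_pureDr u : {morph tcoord_pure u : a b / a + b}.
Proof. by move=> a b; apply/ffunP => k; rewrite !ffunE mulrzDl. Qed.

(** The Lie ring is free on [hbasis] as an abelian group, so its tensor product with A is the module
    of functions K -> A; this is the identification. *)
Definition tcoord : LA -> {ffun K -> A} := tensor_lift tcoord_pure.

Lemma tcoordE u a : tcoord (tens u a) = [ffun k => a *~ (u : {ffun K -> int}) k].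
Proof. exact: (tensor_liftE tcoord_pureDl tcoord_pureDr). Qed.

Lemma tcoordB : {morph tcoord : u v / u - v}.
Proof. exact: (tensor_liftB tcoord_pureDl tcoord_pureDr). Qed.

HB.instance Definition _ := GRing.isZmodMorphism.Build LA {ffun K -> A} tcoord tcoordB.

Definition hbasis (k : K) : L := [ffun k' => (k' == k)%:Z].

Definition tcoord_inv (v : {ffun K -> A}) : LA := \sum_k tens (hbasis k) (v k).

Lemma tcoord_invK : cancel tcoord_inv tcoord.
Proof.
move=> v; apply/ffunP => k; rewrite raddf_sum sum_ffunE (bigD1 k) //=.
rewrite tcoordE !ffunE eqxx mulr1z big1 ?addr0 // => k' kk'.
by rewrite tcoordE !ffunE eq_sym (negPf kk') mulr0z.
Qed.

Lemma tcoord_inv_is_additive : zmod_morphism tcoord_inv.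
Proof.
move=> u v; rewrite /tcoord_inv -sumrB; apply: eq_bigr => k _; rewrite !ffunE.
have := tensDr (hbasis k) (u k - v k) (v k); rewrite subrK => ->.
by rewrite addrK.
Qed.

HB.instance Definition _ := GRing.isZmodMorphism.Build {ffun K -> A} LA tcoord_inv
  tcoord_inv_is_additive.

(** The partial maps of the tensor sign are named so that they can be declared additive and commute
    with sums and integer multiples. *)
Let tensl (a : A) (u : L) : LA := tens u a.
Let tensl_is_additive a : zmod_morphism (tensl a).
Proof.
move=> u v; have := tensDl (u - v) v a; rewrite subrK /tensl => ->.
by rewrite addrK.
Qed.
HB.instance Definition _ a := GRing.isZmodMorphism.Build L LA (tensl a)
  (tensl_is_additive a).
Let tensr (u : L) (a : A) : LA := tens u a.
Let tensr_is_additive a : zmod_morphism (tensr a).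
Proof.
move=> u v; have := tensDr a (u - v) v; rewrite subrK /tensr => ->.
by rewrite addrK.
Qed.
HB.instance Definition _ a := GRing.isZmodMorphism.Build A LA (tensr a)
  (tensr_is_additive a).

Lemma tens_mulrz (u : L) (a : A) n : tens u (a *~ n) = tens (u *~ n) a.
Proof.
by rewrite -[LHS]/(tensr u (a *~ n)) raddfMz -[RHS]/(tensl a (u *~ n)) raddfMz.
Qed.

Lemma hbasis_decomp (u : L) : u = \sum_k hbasis k *~ (u : {ffun K -> int}) k.
Proof.
apply/ffunP => k; rewrite sum_ffunE (bigD1 k) //= big1 ?addr0 => [|k' kk'].
  by rewrite ffunMzE ffunE eqxx intz.
by rewrite ffunMzE ffunE eq_sym (negPf kk') mul0rz.
Qed.

(** On a pure tensor, expand u in the basis and move its integer coefficients across the tensor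
    sign. *)
Lemma tcoordK : cancel tcoord tcoord_inv.
Proof.
move=> x; elim/tensor_ind: x => [u a|x y IHx IHy]; last first.
  by rewrite !raddfB /= IHx IHy.
rewrite /tcoord_inv tcoordE [u in RHS]hbasis_decomp -[RHS]/(tensl a _) raddf_sum.
by apply: eq_bigr => k _; rewrite ffunE tens_mulrz.
Qed.

Lemma tcoord_lie (x y : LA) :
  tcoord (lie x y) = beta t (tcoord x) (tcoord y) - beta t (tcoord y) (tcoord x).
Proof.
elim/tensor_ind: x y => [u a|x x' IHx IHx'] y; last first.
  rewrite [lie _ _]tensor_lieBl !raddfB /= [tcoord _]IHx [X in _ - X]IHx'.
  by rewrite betaDl betaNl betaDr betaNr !opprB addrA [LHS](ACl (1*4*(3*2))%AC).
elim/tensor_ind: y => [v b|y y' IHy IHy']; last first.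
  rewrite [lie _ _]tensor_lieBr !raddfB /= [tcoord _]IHy [X in _ - X]IHy'.
  by rewrite betaDl betaNl betaDr betaNr !opprB addrA [LHS](ACl (1*4*(3*2))%AC).
rewrite [lie _ _]tensor_lieE !tcoordE.
apply/ffunP => -[[i|i]|j]; rewrite !ffunE ?subr0 ?mulr0z //.
rewrite mulrzBr !mulrz_sumr; congr (_ - _); apply: eq_bigr => i _.
  by rewrite !ffunE mulrzAl mulrzAr -mulrzA; congr (_ *~ _); apply: mulrC.
by rewrite !ffunE mulrzAl mulrzAr -mulrzA [a * b]mulrC; congr (_ *~ _); apply: mulrC.
Qed.
End TensorCoordinates.

Section HeisenbergExp.
Variables (I J : finType) (t : I -> J) (F : finFieldType) (p f : nat).
Local Notation K := (hidx I J).
Local Notation LA := (tensor (heis_lie t) F).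
Hypotheses (p_prime : prime p) (oF : #|F| = (p ^ f)%N).
(** For p = 2 the bound on the degree forces deg g = 0, hence no pairs (x_i, y_i): the Lie ring is
    then abelian and its exponential is the additive group. *)
Hypothesis I_small : (2 < p)%N \/ #|I| = 0%N.

Let pF : p \in [pchar F]. Proof. exact: card_finPcharP oF p_prime. Qed.

Let ffun_torsion (v : {ffun K -> F}) : v *+ p = 0.
Proof. by apply/ffunP => k; rewrite ffunMnE ffunE -mulr_natr pcharf0 ?mulr0. Qed.

Let tcoord_inj : injective (@tcoord I J t F) := can_inj (@tcoordK I J t F).

Let torsion (x : LA) : x *+ p = 0.
Proof. by apply: tcoord_inj; rewrite raddfMn raddf0 ffun_torsion. Qed.

Let lie3 (x y z : LA) : lie x (lie y z) = 0.
Proof.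
apply: tcoord_inj; rewrite raddf0 !tcoord_lie.
by rewrite betaDl betaDr betaNl betaNr !beta_betal !beta_betar !subr0.
Qed.

Let beta_I0 : #|I| = 0%N -> forall u v : {ffun K -> F}, beta t u v = 0.
Proof.
move=> I0 u v; apply/ffunP => -[[i|i]|j]; rewrite !ffunE //.
by rewrite big1 // => i _; have := fintype0 i I0.
Qed.

Lemma tcoord_bch (x y : LA) :
  tcoord (bch p x y) = tcoord x + tcoord y
    + (beta t (tcoord x) (tcoord y) - beta t (tcoord y) (tcoord x)) *+ uphalf p.
Proof.
have [p2|p2] := ltnP 2 p; first by rewrite bch_class2 // !raddfD raddfMn /= tcoord_lie.
case: I_small => [|I0]; first by rewrite ltnNge p2.
have p2' : p = 2%N by apply/eqP; rewrite eqn_leq p2 prime_gt1.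
(* For p = 2 the truncated series consists of its degree 1 part alone. *)
rewrite /bch p2' big_nat1 (@dynkin_sum1 _ 2) //; last by rewrite -p2'.
by rewrite raddfD !beta_I0 // subrr mul0rn addr0.
Qed.

(* For odd p, [uphalf p] is the inverse of 2 modulo p: adding half of beta(x, x)
   turns the alternating cocycle of the series into beta. *)
Definition heis_exp (x : LA) : heis_group F t :=
  tcoord x + beta t (tcoord x) (tcoord x) *+ uphalf p.

(** The correction has only z-coordinates and [beta] ignores these, so subtracting the same
    expression undoes it. *)
Lemma heis_exp_bij : bijective heis_exp.
Proof.
exists (fun v : heis_group F t =>
  tcoord_inv t ((v : {ffun K -> F}) - beta t v v *+ uphalf p)) => [x|v].
  rewrite -[RHS]tcoordK; congr tcoord_inv; rewrite /heis_exp.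
  rewrite !(betaDl, betaDr, betaMnl, betaMnr, beta_betal, beta_betar).
  by rewrite !mul0rn !addr0 addrK.
rewrite /heis_exp tcoord_invK -!mulNrn.
rewrite !(betaDl, betaDr, betaMnl, betaMnr, betaNl, betaNr, beta_betal, beta_betar).
by rewrite !(mul0rn, oppr0, addr0) mulNrn addrNK.
Qed.

Let halfK (u v : {ffun K -> F}) : beta t u v *+ uphalf p *+ 2 = beta t u v.
Proof.
case: I_small => [p2|I0]; last by rewrite beta_I0 // !mul0rn.
have podd : odd p by case: (even_prime p_prime) p2 => [->|].
by rewrite -mulrnA muln2 uphalfK podd mulrSr ffun_torsion add0r.
Qed.

(** With b for [beta], half of b(x + y, x + y) plus half of b(x, y) - b(y, x) equals half of b(x, x)
    + b(y, y), plus b(x, y). *)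
Lemma heis_expM (x y : LA) : heis_exp (bch p x y) = (heis_exp x * heis_exp y)%g.
Proof.
rewrite heis_mulE /heis_mul /heis_exp tcoord_bch.
rewrite !(betaDl, betaDr, betaMnl, betaMnr, betaNl, betaNr, beta_betal, beta_betar).
rewrite !(mul0rn, oppr0, addr0) -[X in _ = _ + X]halfK.
rewrite !(mulrnBl, mulrnDl) mulr2n !addrA [LHS](ACl ((1*5)*(2*8)*(3*6)*(4*7)))%AC /=.
by rewrite addNr addr0 !addrA.
Qed.

Lemma heis_is_exp : is_exp LA p (heis_group F t).
Proof.
split; last by exists heis_exp; split; [exact: heis_exp_bij | exact: heis_expM].
  rewrite /pgroup cardsT card_ffun pnatX.
  by rewrite oF pnatX pnat_id.
have [p2 x|p2] := ltnP 2 p.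
  by rewrite -(subnKC p2); apply: lcs_class2.
(* For p = 2 the class has to be at most 1, that is, [lcs 1] must vanish; the bracket is 0 since I
   is empty. *)
case: I_small => [|I0]; first by rewrite ltnNge p2.
have -> : p = 2%N by apply/eqP; rewrite eqn_leq p2 prime_gt1.
move=> x; elim=> {x} [x [a [b [_ ->]]]|//|x y _ -> _ ->]; last by rewrite subrr.
by apply: tcoord_inj; rewrite raddf0 tcoord_lie !beta_I0 // subrr.
Qed.

End HeisenbergExp.

(** * Monomial representations and weights *)

(** F is a vector space of dimension f over its prime field; additivity of the coordinates is what
    additive characters call for. *)
Lemma Fp_coordinates (F : finFieldType) (p f : nat) :
  prime p -> #|F| = (p ^ f)%N ->
  exists2 c : F -> 'rV['F_p]_f, zmod_morphism c & bijective c.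
Proof.
move=> p_prime oF; have pF := card_finPcharP oF p_prime.
have : Vector.axiom (logn p #|F|) (pPrimeCharType pF) := pprimeChar_vectAxiom pF.
rewrite oF pfactorK // => -[c cL cB]; exists c => // u v.
by rewrite addrC [RHS]addrC; have := cL (-1) v u; rewrite !scaleN1r.
Qed.

(** A root of 1 + X + ... + X^(p-1) has order dividing p, and order 1 would give p = 0 in C. *)
Lemma prim_root_exists (C : numClosedFieldType) (p : nat) :
  prime p -> exists z : C, p.-primitive_root z.
Proof.
move=> p_prime; have p_gt1 := prime_gt1 p_prime.
have [z /rootP z0] : exists z : C, root (\poly_(i < p) 1) z.
  by apply/closed_rootP; rewrite size_poly_eq ?oner_neq0 // neq_ltn p_gt1 orbT.
have sz0 : \sum_(i < p) z ^+ i = 0.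
  by rewrite -[RHS]z0 horner_poly; apply: eq_bigr => i _; rewrite mul1r.
have zp : z ^+ p = 1.
  by apply/eqP; rewrite -subr_eq0 subrX1 sz0 mulr0.
have [m prim_z m_p] := prim_order_exists (prime_gt0 p_prime) zp.
exists z; case/primeP: p_prime => _ /(_ _ m_p) /orP[] /eqP mE; last by rewrite -mE.
move: (prim_expr_order prim_z) sz0; rewrite mE expr1 => ->.
under eq_bigr do rewrite expr1n.
rewrite sumr_const card_ord => /eqP; rewrite pnatr_eq0 => /eqP p0.
by rewrite p0 in p_gt1.
Qed.

Section RootPowers.
Variables (C : numClosedFieldType) (p : nat) (z : C).
Hypotheses (p_prime : prime p) (prim_z : p.-primitive_root z).

Definition zpow (a : 'F_p) : C := z ^+ (a : nat).

Lemma zpow0 : zpow 0 = 1. Proof. exact: expr0. Qed.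

Lemma zpowD (a b : 'F_p) : zpow (a + b) = zpow a * zpow b.
Proof.
rewrite /zpow -exprD -(prim_expr_mod prim_z (a + b)%N); congr (_ ^+ _).
by rewrite /=; congr modn; apply: Fp_cast.
Qed.

Lemma zpow_inj : injective zpow.
Proof.
move=> a b /eqP; rewrite /zpow (eq_prim_root_expr prim_z) => /eqP.
have lt_p (c : 'F_p) : (c < p)%N by rewrite -[X in (_ < X)%N](Fp_cast p_prime).
by rewrite !modn_small // => /val_inj.
Qed.

Lemma zpow_surj (w : C) : w ^+ p = 1 -> exists a, w = zpow a.
Proof.
move/(prim_rootP prim_z) => [i ->]; exists (inZp i).
by rewrite /zpow /= [X in (_ %% X)%N]Fp_cast // modn_small.
Qed.

End RootPowers.

Section MonomialRepresentation.
Variables (C : fieldType) (gT : finGroupType) (Om : finType).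
Variables (act : gT -> Om -> Om) (mult : gT -> Om -> C).
Hypothesis act1 : forall w, act 1%g w = w.
Hypothesis actM : forall x y w, act (x * y)%g w = act y (act x w).
Hypothesis mult1 : forall w, mult 1%g w = 1.
Hypothesis multM : forall x y w, mult (x * y)%g w = mult x w * mult y (act x w).

(** Matrices act on row vectors from the right, so [act] is a right action and [multM] is the
    matching cocycle condition. *)
Definition monomial_mx (x : gT) : 'M[C]_#|Om| :=
  \matrix_(r, s) (mult x (enum_val r) *+ (enum_val s == act x (enum_val r))).

Lemma monomial_mx_repr : mx_repr [set: gT] monomial_mx.
Proof.
split=> [|x y _ _]; apply/matrixP => r s; rewrite !mxE.
  by rewrite act1 mult1 (inj_eq enum_val_inj) eq_sym.
rewrite (bigD1 (enum_rank (act x (enum_val r)))) //= !mxE enum_rankK eqxx mulr1n.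
rewrite big1 ?addr0 => [|k kr]; first by rewrite actM multM mulrnAr.
rewrite !mxE [_ == act x _](_ : _ = false) ?mulr0n ?mul0r //.
by apply: contraNF kr => /eqP <-; rewrite enum_valK.
Qed.

Definition monomial_repr := MxRepresentation monomial_mx_repr.

Lemma monomial_faithful :
  (forall x, (forall w, act x w = w /\ mult x w = 1) -> x = 1%g) ->
  mx_faithful monomial_repr.
Proof.
move=> faith; apply/subsetP => x /rkerP[_ /matrixP x1]; rewrite inE; apply/eqP.
apply: faith => w; move: (x1 (enum_rank w) (enum_rank w)).
rewrite !mxE enum_rankK eqxx; case: eqP => [<- //|_] /eqP.
by rewrite eq_sym oner_eq0.
Qed.
End MonomialRepresentation.

Lemma row_diag_mul (F : fieldType) (m n : nat) (d : 'rV[F]_m) (P : 'M_(m, n)) i :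
  row i (diag_mx d *m P) = d 0 i *: row i P.
Proof. by rewrite row_mul row_diag_mx -scalemxAl -rowE. Qed.

(** * Weights of a representation on an elementary abelian subset *)

Section ElementaryAbelianWeights.
Variables (C : numClosedFieldType) (p : nat) (z : C).
Hypotheses (p_prime : prime p) (prim_z : p.-primitive_root z).
Variables (gT : finGroupType) (G : {group gT}) (n : nat).
Variable rG : mx_representation C G n.
Variable A : {set gT}.
Hypotheses (sAG : A \subset G) (cAA : {in A &, commutative mulg}).
Hypothesis (A_exp : {in A, forall u, (u ^+ p = 1)%g}).

(** The matrix is annihilated by X^p - 1, whose roots, the powers of z, are distinct. *)
Lemma diagonalizable_repr u : u \in G -> (u ^+ p = 1)%g -> diagonalizable (rG u).
Proof.
move=> Gu up; case: n rG => [|n'] rG'.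
  by rewrite [rG' u]thinmx0; apply: diagonalizable0.
apply/diagonalizableP; exists [seq z ^+ i | i <- index_iota 0 p].
  rewrite map_inj_in_uniq ?iota_uniq // => i j.
  rewrite !mem_index_iota /= => ip jp /eqP.
  by rewrite (eq_prim_root_expr prim_z) !modn_small // => /eqP.
rewrite big_map (factor_Xn_sub_1 prim_z); apply: mxminpoly_min.
by rewrite rmorphB rmorph1 rmorphXn /= horner_mx_X -repr_mxX // up repr_mx1 subrr.
Qed.

(** Commuting diagonalisable matrices share an eigenbasis, the rows of P. The eigenvalues are p-th
    roots of unity, recorded by their exponents in F_p. *)
Lemma weights_exist : exists (P : 'M[C]_n) (l : 'I_n -> gT -> 'F_p),
  P \in unitmx /\
  forall i u, u \in A -> row i P *m rG u = zpow z (l i u) *: row i P.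
Proof.
have [] : codiagonalizable [seq rG u | u in A].
  apply/codiagonalizableP; split=> [M N|M] /imageP[u Au ->].
    move=> /imageP[v Av ->]; rewrite /comm_mx -!repr_mxM ?(subsetP sAG) //.
    by rewrite cAA.
  by apply: diagonalizable_repr; [apply: (subsetP sAG)|apply: A_exp].
move=> P Pu /allP Pdiag.
have Prow i u : u \in A -> exists a : 'F_p, row i P *m rG u = zpow z a *: row i P.
  move=> Au; have Gu := subsetP sAG u Au.
  have /Pdiag /= /diagonalizable_forPex [d /(simmxP Pu) dP] :
      rG u \in [seq rG u | u in A].
    by apply: image_f.
  have rE : row i P *m rG u = d 0 i *: row i P.
    by rewrite -row_mul dP row_diag_mul.
  have rX k : row i P *m rG (u ^+ k)%g = d 0 i ^+ k *: row i P.
    elim: k => [|k IH]; first by rewrite repr_mx1 mulmx1 expr0 scale1r.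
    by rewrite expgSr repr_mxM ?groupX // mulmxA IH -scalemxAl rE scalerA exprSr.
  have := rX p; rewrite A_exp // repr_mx1 mulmx1 => /esym/eqP.
  rewrite -[X in _ == X]scale1r -subr_eq0 -scalerBl scaler_eq0 subr_eq0.
  case/orP=> [/eqP/(zpow_surj p_prime prim_z)[a da]|/eqP r0].
    by exists a; rewrite rE da.
  (* If the row were 0 any weight would do, and 0 is taken. *)
  have : row_free P by rewrite row_free_unit.
  by move/row_freeP => [Q PQ]; exists 0; rewrite r0 mul0mx scaler0.
(* Choice is made over all pairs (i, u), with default weight 0 outside [A]. *)
have /fin_all_exists[l lP] : forall iu : 'I_n * gT, exists a : 'F_p,
    iu.2 \in A -> row iu.1 P *m rG iu.2 = zpow z a *: row iu.1 P.
  move=> [i u]; have [/(Prow i)[a ?]|uA] := boolP (u \in A); first by exists a.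
  by exists 0 => /= Au; case/negP: uA.
by exists P, (fun i u => l (i, u)); split=> // i u; apply: (lP (i, u)).
Qed.

Section Weights.
Variables (P : 'M[C]_n) (l : 'I_n -> gT -> 'F_p).
Hypothesis P_unit : P \in unitmx.
Hypothesis lP : forall i u, u \in A -> row i P *m rG u = zpow z (l i u) *: row i P.

Let row_neq0 i : row i P != 0.
Proof.
apply/eqP => r0; have := congr1 (row i) (mulmxV P_unit).
rewrite row_mul r0 mul0mx row1 => /rowP/(_ i); rewrite !mxE !eqxx => /eqP.
by rewrite eq_sym oner_eq0.
Qed.

Let row_scale_inj i (a b : C) : a *: row i P = b *: row i P -> a = b.
Proof.
move/eqP; rewrite -subr_eq0 -scalerBl scaler_eq0 (negPf (row_neq0 i)) orbF subr_eq0.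
by move/eqP.
Qed.

Lemma weightM i u v : u \in A -> v \in A -> (u * v)%g \in A ->
  l i (u * v)%g = l i u + l i v.
Proof.
move=> Au Av Auv; apply: (zpow_inj p_prime prim_z); apply: (@row_scale_inj i).
rewrite -lP // repr_mxM ?(subsetP sAG) // mulmxA lP // -scalemxAl lP //.
by rewrite scalerA (zpowD p_prime prim_z).
Qed.

Lemma weight_faithful u : mx_faithful rG -> u \in A -> (forall i, l i u = 0) -> u = 1%g.
Proof.
move=> /mx_faithful_inj inj Au l0; apply: (inj u 1%g (subsetP sAG u Au) (group1 G)).
rewrite repr_mx1; apply: (can_inj (mulKmx P_unit)); rewrite mulmx1.
by apply/row_matrixP => i; rewrite row_mul lP // l0 zpow0 scale1r.
Qed.

(** Translating the i-th eigenvector by g gives an eigenvector w with the conjugated weight. Any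
    eigenbasis vector occurring in w with nonzero coefficient has that same weight. *)
Lemma weight_conj i g : g \in G -> {in A, forall u, (g * u * g^-1)%g \in A} ->
  exists m, {in A, forall u, l m u = l i (g * u * g^-1)%g}.
Proof.
move=> Gg gA; pose w := row i P *m rG g.
have w0 : w != 0.
  apply: contraNneq (row_neq0 i) => w0.
  by rewrite -(mulmxK (repr_mx_unit rG Gg) (row i P)) -/w w0 mul0mx.
have wE u : u \in A -> w *m rG u = zpow z (l i (g * u * g^-1)%g) *: w.
  move=> Au; have Gu := subsetP sAG u Au.
  rewrite /w -mulmxA -repr_mxM // scalemxAl -lP ?gA // -mulmxA.
  rewrite -repr_mxM ?groupM ?groupV //.
  by rewrite mulgKV.
have /rV0Pn[m m0] : w *m invmx P != 0.
  by apply: contraNneq w0 => w0; rewrite -(mulmxKV P_unit w) w0 mul0mx.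
exists m => u Au; apply: (zpow_inj p_prime prim_z).
have PuE : P *m rG u = diag_mx (\row_k zpow z (l k u)) *m P.
  by apply/row_matrixP => k; rewrite row_mul lP // row_diag_mul mxE.
have: w *m invmx P *m (P *m rG u) = zpow z (l i (g * u * g^-1)%g) *: w.
  by rewrite mulmxA mulmxKV // wE.
rewrite PuE mulmxA.
move/(congr1 (mulmx^~ (invmx P))); rewrite -scalemxAl mulmxK // mul_mx_diag.
move/rowP/(_ m); rewrite !mxE mulrC; apply: mulIf.
by move: m0; rewrite !mxE.
Qed.

End Weights.
End ElementaryAbelianWeights.

(** A nonzero maximal minor has a nonzero term, which matches each column with a row. The chosen
    rows differ as vectors, since a minor with two equal rows vanishes. *)
Lemma row_full_transversal (F : fieldType) (n N : nat) (M : 'M[F]_(n, N)) :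
  row_full M -> exists h : 'I_N -> 'I_n,
    (forall r, M (h r) r != 0) /\ (forall r r', row (h r) M = row (h r') M -> r = r').
Proof.
move=> fM; have := fullrowsub_unit fM; set k := fullrankfun fM.
rewrite unitmxE unitfE => d0.
have [s s0] : exists s : 'S_N, \prod_i M (k i) (s i) != 0.
  apply/existsP; apply: contraNT d0 => /existsPn s0.
  apply/eqP/big1 => s _; have := s0 s; rewrite negbK => /eqP.
  by under [X in _ * X]eq_bigr do rewrite mxE; move=> ->; rewrite mulr0.
exists (fun r => k ((s^-1)%g r)); split=> [r|r r' /rowP rr].
  by move/prodf_neq0: s0 => /(_ ((s^-1)%g r) isT); rewrite permKV.
apply: (@perm_inj _ (s^-1)%g); apply/eqP; apply: contraNT d0 => nrr.
rewrite (determinant_alternate nrr) // => j.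
by have := rr j; rewrite !mxE.
Qed.

(** * Faithful representations of Heisenberg groups *)

Section HeisenbergFaithful.
Variables (I J : finType) (t : I -> J) (F : finFieldType) (p f : nat).
Local Notation K := (hidx I J).
Local Notation V := {ffun hidx I J -> F}.
Local Notation G := (heis_group F t).
Implicit Types u v : V.
Hypothesis p_prime : prime p.
Hypothesis oF : #|F| = (p ^ f)%N.
Variables (C : numClosedFieldType) (z : C).
Hypothesis prim_z : p.-primitive_root z.
Variable c : F -> 'rV['F_p]_f.
Hypotheses (c_add : zmod_morphism c) (c_bij : bijective c).
HB.instance Definition _ := GRing.isZmodMorphism.Build F 'rV['F_p]_f c c_add.

(* (j, k, s) indexes the delta function at s in the Schroedinger representation of
   the j-th summand with additive character a |-> z ^ (c a)_k; a point of F^{d_j}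
   is encoded as a function on all of I vanishing outside the j-th fibre of t. *)
Definition supported (w : J * 'I_f * {ffun I -> F}) : bool :=
  [forall i, (t i != w.1.1) ==> (w.2 i == 0)].
Definition schrodinger_idx : Type := {w : J * 'I_f * {ffun I -> F} | supported w}.
HB.instance Definition _ := Finite.on schrodinger_idx.

Lemma card_schrodinger_idx :
  #|{: schrodinger_idx}| = (f * \sum_j (p ^ f) ^ #|[pred i | t i == j]|)%N.
Proof.
rewrite card_sig -sum1_card.
pose sup (j : J) := pffun_on (0 : F) [pred i | t i == j] predT.
rewrite (eq_bigl (fun w => (w.1 \in predT) && (w.2 \in sup w.1.1))); last first.
  case=> -[j k] s /=; apply/forallP/pffun_onP => /= [sP|[sP _] i].
    split=> //; apply/subsetP => i; rewrite !inE => si.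
    by have := sP i; rewrite (negPf si) implybF negbK.
  apply/implyP => tij; apply: contraNT tij => si.
  by have := subsetP sP i; rewrite !inE => ->.
rewrite -(pair_big_dep predT (fun jk s => s \in sup jk.1) (fun _ _ => 1%N)) /=.
under eq_bigr do rewrite sum1_card card_pffun_on oF.
rewrite -(pair_big predT predT
  (fun j (k : 'I_f) => (p ^ f) ^ #|[pred i | t i == j]|)%N) /=.
rewrite big_distrr /=; apply: eq_bigr => j _.
by rewrite sum_nat_const card_ord.
Qed.

Lemma restrict_supported (w : schrodinger_idx) (u : G) :
  supported ((val w).1,
    [ffun i => (val w).2 i + (if t i == (val w).1.1 then (u : V) (xc J i) else 0)]).
Proof.
apply/forallP => i; apply/implyP => /= ti; rewrite ffunE (negPf ti) addr0.
by move/forallP: (valP w) => /(_ i); rewrite ti.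
Qed.

Definition schrodinger_act (u : G) (w : schrodinger_idx) : schrodinger_idx :=
  Sub _ (restrict_supported w u).

(** u carries the point s to s + x and multiplies by the k-th character of z_j + <s, y>. *)
Definition schrodinger_mult (u : G) (w : schrodinger_idx) : C :=
  let: (j, k, s) := val w in
  zpow z
    (c ((u : V) (zc I j) + \sum_(i | t i == j) s i * (u : V) (yc J i)) 0 k).

(** For faithfulness, the multipliers at s = 0 detect z, the translation of s = 0 detects x, and the
    multipliers at unit vectors s then detect y. *)
Lemma schrodinger_repr_exists :
  exists rG : mx_representation C [set: G] #|{: schrodinger_idx}|, mx_faithful rG.
Proof.
have a1 w : schrodinger_act 1%g w = w.
  apply: val_inj; case: w => [[[j k] s] ws] /=; congr (_, _).
  by apply/ffunP => i; rewrite !ffunE if_same addr0.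
have aM x y w : schrodinger_act (x * y)%g w = schrodinger_act y (schrodinger_act x w).
  apply: val_inj; case: w => [[[j k] s] ws] /=; congr (_, _).
  apply/ffunP => i; rewrite !ffunE addr0 -addrA; congr (_ + _).
  by case: ifP; rewrite // addr0.
have m1 w : schrodinger_mult 1%g w = 1.
  case: w => [[[j k] s] ws]; rewrite /schrodinger_mult /= !ffunE add0r big1.
    by rewrite raddf0 mxE zpow0.
  by move=> i _; rewrite ffunE mulr0.
(* The term <x, y'> in the z-coordinate of a product is the one that arises from replacing s by s +
   x. *)
have mM x y w : schrodinger_mult (x * y)%g w =
    schrodinger_mult x w * schrodinger_mult y (schrodinger_act x w).
  case: w => [[[j k] s] ws]; rewrite /schrodinger_mult /=.
  have cD a b : c (a + b) 0 k = c a 0 k + c b 0 k by rewrite raddfD mxE.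
  rewrite -(zpowD p_prime prim_z) -cD; congr (zpow z (c _ 0 k)).
  have -> : \sum_(i | t i == j) s i * ((x * y)%g : V) (yc J i)
      = \sum_(i | t i == j) s i * (x : V) (yc J i)
        + \sum_(i | t i == j) s i * (y : V) (yc J i).
    by rewrite -big_split; apply: eq_bigr => i _; rewrite !ffunE addr0 mulrDr.
  have -> : \sum_(i | t i == j)
        [ffun i0 => s i0 + (if t i0 == j then (x : V) (xc J i0) else 0)] i
          * (y : V) (yc J i)
      = \sum_(i | t i == j) s i * (y : V) (yc J i)
        + \sum_(i | t i == j) (x : V) (xc J i) * (y : V) (yc J i).
    by rewrite -big_split; apply: eq_bigr => i ti; rewrite !ffunE ti mulrDl.
  by rewrite !ffunE !addrA [LHS](ACl (1*4*2*5*3))%AC.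
exists (monomial_repr a1 aM m1 mM); apply: monomial_faithful => u uP.
(* F has more than one element, so some index k exists for the translation test. *)
have f_gt0 : (0 < f)%N.
  by rewrite lt0n; apply/eqP => f0; have := finNzRing_gt1 F; rewrite oF f0.
have supp0 j a : supported (j, a, [ffun=> 0]).
  by apply/forallP => i; rewrite ffunE eqxx implybT.
have supp1 i0 a : supported (t i0, a, [ffun i => (i == i0)%:R]).
  apply/forallP => i; rewrite ffunE /=; apply/implyP; apply: contraNT.
  by have [->|_] := eqVneq i i0; rewrite ?eqxx.
have c0 a : (forall k, zpow z (c a 0 k) = 1) -> a = 0.
  move=> ca; apply: (bij_inj c_bij); rewrite raddf0; apply/rowP => k.
  by rewrite mxE; apply: (zpow_inj p_prime prim_z); rewrite ca zpow0.
have uz j : (u : V) (zc I j) = 0.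
  apply: c0 => k; have [_ <-] := uP (Sub _ (supp0 j k)).
  rewrite /schrodinger_mult /= big1 ?addr0 // => i _.
  by rewrite ffunE mul0r.
apply/ffunP => -[[i|i]|j]; rewrite ffunE; last exact: uz.
- have [/(congr1 val)/(congr1 snd)/ffunP/(_ i) + _] :=
    uP (Sub _ (supp0 (t i) (Ordinal f_gt0))).
  by rewrite /= !ffunE eqxx add0r.
- apply: c0 => k; have [_ <-] := uP (Sub _ (supp1 i k)).
  rewrite /schrodinger_mult /= uz add0r (bigD1 i) //= big1 ?addr0 => [|i' /andP[_ ii']].
    by rewrite ffunE eqxx mul1r.
  by rewrite ffunE (negPf ii') mul0r.
Qed.

(** * Lower bound for the dimension of a faithful representation *)

Section LowerBound.
Variables (n : nat) (rG : mx_representation C [set: G] n).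
Hypothesis rG_faithful : mx_faithful rG.

Definition xel (s : {ffun I -> F}) : V :=
  [ffun k => if k is inl (inl i) then s i else 0].
Definition yel (i0 : I) (a : F) : V :=
  [ffun k => if k == yc J i0 then a else 0].
Definition zel (j0 : J) (a : F) : V :=
  [ffun k => if k == zc I j0 then a else 0].

Definition yz_set : {set G} := [set u : G | [forall i, (u : V) (xc J i) == 0]].

Lemma yz_setP (u : G) : reflect (forall i, (u : V) (xc J i) = 0) (u \in yz_set).
Proof. by rewrite inE; apply: (iffP forallP) => u0 i; apply/eqP. Qed.

Lemma beta_yzl u v : (u : G) \in yz_set -> beta t u v = 0.
Proof.
move/yz_setP => u0; apply/ffunP => -[[i|i]|j]; rewrite !ffunE //.
by rewrite big1 // => i _; rewrite u0 mul0r.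
Qed.

Lemma yz_mul u v : (u : G) \in yz_set -> ((u : G) * (v : G))%g = u + v.
Proof. by move=> uA; rewrite heis_mulE /heis_mul beta_yzl // addr0. Qed.

Lemma yz_setD u v : (u : G) \in yz_set -> (v : G) \in yz_set -> (u + v : G) \in yz_set.
Proof.
by move=> /yz_setP u0 /yz_setP v0; apply/yz_setP => i; rewrite ffunE u0 v0 addr0.
Qed.

Lemma beta_yz u v : (beta t u v : G) \in yz_set.
Proof. by apply/yz_setP => i; rewrite ffunE. Qed.

Lemma zel_yz j a : (zel j a : G) \in yz_set.
Proof. by apply/yz_setP => i; rewrite ffunE. Qed.

Lemma yel_yz i a : (yel i a : G) \in yz_set.
Proof. by apply/yz_setP => i'; rewrite ffunE. Qed.

Lemma conj_xel s u : (u : G) \in yz_set ->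
  ((xel s : G) * u * (xel s : G)^-1)%g = u + beta t (xel s) u.
Proof.
move=> uA; apply: (canLR (mulgK _)).
rewrite (yz_mul _ (yz_setD uA (beta_yz _ _))) heis_mulE /heis_mul.
by rewrite -addrA addrC.
Qed.

Lemma beta_xel_yel s i a : beta t (xel s) (yel i a) = zel (t i) (s i * a).
Proof.
apply/ffunP => -[[i'|i']|j]; rewrite !ffunE // /zc (inj_eq inr_inj) eq_sym.
case: eqP => [<-|/eqP tij].
  rewrite (bigD1 i) //= big1 ?addr0 => [|i' /andP[_ ii']].
    by rewrite !ffunE eqxx.
  rewrite !ffunE /yc (inj_eq inl_inj) (inj_eq inr_inj).
  by rewrite (negPf ii') mulr0.
rewrite big1 // => i' /eqP ti'; rewrite !ffunE /yc (inj_eq inl_inj) (inj_eq inr_inj).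
by case: eqP => [ii'|]; rewrite ?mulr0 // -ti' ii' eqxx in tij *.
Qed.

Lemma beta_zel u j a : beta t u (zel j a) = 0.
Proof.
apply/ffunP => -[[i|i]|j']; rewrite !ffunE //.
by rewrite big1 // => i _; rewrite ffunE mulr0.
Qed.

Lemma xelB s s' u : beta t (xel (s - s')) u = beta t (xel s) u - beta t (xel s') u.
Proof.
rewrite -betaNl -betaDl; congr beta.
by apply/ffunP => -[[i|i]|j]; rewrite !ffunE // subr0.
Qed.

(** The Schroedinger indices inject into the eigenbasis: (j, k, s) goes to a vector whose weight is
    the one chosen for (j, k), conjugated by [xel s]. *)
Lemma faithful_bound : (#|{: schrodinger_idx}| <= n)%N.
Proof.
have sAG : yz_set \subset [set: G] by apply: subsetT.
have cAA : {in yz_set &, commutative mulg}.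
  by move=> u v uA vA; rewrite !yz_mul // addrC.
have yz0 : ((0 : V) : G) \in yz_set by apply/yz_setP => i; rewrite ffunE.
have yz_exp u m : (u : G) \in yz_set ->
    ((u : G) ^+ m)%g = u *+ m /\ (u *+ m : G) \in yz_set.
  move=> uA; elim: m => [|m [IHe IHA]]; first by rewrite expg0 mulr0n.
  by rewrite expgS IHe yz_mul // -mulrS; split=> //; rewrite mulrS yz_setD.
have pF := card_finPcharP oF p_prime.
have A_exp : {in yz_set, forall u : G, (u ^+ p = 1)%g}.
  move=> u uA; have [-> _] := yz_exp u p uA; apply/ffunP => k.
  by rewrite ffunMnE !ffunE -mulr_natr pcharf0 ?mulr0.
have [P [l [P_unit lP]]] := weights_exist p_prime prim_z rG sAG cAA A_exp.
have lD i u v : (u : G) \in yz_set -> (v : G) \in yz_set -> l i (u + v) = l i u + l i v.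
  move=> uA vA; have := weightM p_prime prim_z sAG P_unit lP i uA vA.
  by rewrite yz_mul // yz_setD // => ->.
have l0 i : l i (0 : V) = 0.
  by apply: (addrI (l i (0 : V))); rewrite -lD // !addr0.
have lMn i u m : (u : G) \in yz_set -> l i (u *+ m) = l i u *+ m.
  move=> uA; elim: m => [|m IH]; rewrite ?mulr0n // !mulrS lD ?IH //.
  by case: (yz_exp u m uA).
have [c' _ cK] := c_bij.
pose N := #|{: J * 'I_f}|.
(* An F_p-basis of the subgroup of z-coordinates: the standard basis vectors of F_p^f, pulled back
   to F and placed at each j. *)
pose gen (r : 'I_N) := zel (enum_val r).1 (c' (delta_mx 0 (enum_val r).2)).
have genA r : (gen r : G) \in yz_set by apply: zel_yz.
pose M : 'M['F_p]_(n, N) := \matrix_(i, r) l i (gen r).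
(* A linear relation among the columns gives a combination u of the generators on which every weight
   vanishes. Faithfulness makes u trivial, and its coordinates are those of the relation. *)
have M_full : row_full M.
  rewrite /row_full -mxrank_tr -[_ == _]/(row_free M^T); apply: inj_row_free => v vM.
  pose u := \sum_r gen r *+ (v 0 r : nat).
  have [uA lu] : (u : G) \in yz_set /\ forall i, l i u = \sum_r v 0 r * l i (gen r).
    rewrite /u; elim: (index_enum _) => [|r e [eA le]].
      by rewrite big_nil; split=> // i; rewrite big_nil.
    rewrite big_cons; have [_ rA] := yz_exp (gen r) (v 0 r) (genA r).
    split=> [|i]; first by rewrite yz_setD.
    by rewrite big_cons lD // le lMn // -mulr_natl natr_Zp.
  have u1 : u = 0.
    apply: (weight_faithful sAG P_unit lP rG_faithful uA) => i.
    move/rowP/(_ i): vM; rewrite !mxE lu => vMi; rewrite -[RHS]vMi.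
    by apply: eq_bigr => r _; rewrite !mxE.
  apply/rowP => r; rewrite mxE.
  have := congr1 (fun u => c (u (zc I (enum_val r).1)) 0 (enum_val r).2) u1.
  rewrite sum_ffunE !raddf_sum summxE /= (bigD1 r) //= big1 => [|r' rr'].
    rewrite ffunMnE raddfMn !ffunE eqxx mulmxnE /= cK raddf0 !mxE !eqxx.
    by rewrite natr_Zp addr0.
  rewrite ffunMnE raddfMn mulmxnE !ffunE /zc (inj_eq inr_inj).
  case: eqP => [e1|_]; last by rewrite /= raddf0 mxE mul0rn.
  rewrite /= cK mxE eqxx /=; case: eqP => [e2|_]; last by rewrite mul0rn.
  case/eqP: rr'; apply: enum_val_inj.
  by rewrite [LHS]surjective_pairing [RHS]surjective_pairing e1 e2.
have [h [h_neq0 h_inj]] := row_full_transversal M_full.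
have /fin_all_exists[m mP] (w : schrodinger_idx) :
    exists i, forall u, (u : G) \in yz_set ->
    l i u = l (h (enum_rank (val w).1)) (u + beta t (xel (val w).2) u).
  pose x : G := xel (val w).2.
  have gA : {in yz_set, forall u, (x * u * x^-1)%g \in yz_set}.
    by move=> u uA; rewrite conj_xel // yz_setD // beta_yz.
  have [i iP] := weight_conj p_prime prim_z sAG P_unit lP
    (h (enum_rank (val w).1)) (in_setT x) gA.
  by exists i => u uA; rewrite iP // conj_xel.
rewrite -[n]card_ord; apply: (leq_card m) => w w' mw.
(* Conjugation fixes the generators [gen r], so a common eigenvector forces the two chosen rows of M
   to agree. *)
have jk_eq : (val w).1 = (val w').1.
  apply: enum_rank_inj; apply: h_inj; apply/rowP => r; rewrite !mxE.
  have := mP w (gen r) (genA r); rewrite mw mP //.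
  by rewrite !beta_zel !addr0.
apply: val_inj; move: (mP w) (mP w') (valP w) (valP w'); rewrite -mw -jk_eq.
case: (val w) (val w') jk_eq => [[j k] s] [_ s'] /= <- lw lw' sw sw'.
congr (_, _); apply/eqP; rewrite -subr_eq0; apply/eqP/ffunP => i; rewrite [RHS]ffunE.
apply/eqP; apply: contraT => ds.
have tij : t i = j.
  apply/eqP; apply: contraNT ds => tij; rewrite !ffunE.
  move/forallP/(_ i): sw; move/forallP/(_ i): sw'.
  by rewrite /= tij => /eqP-> /eqP->; rewrite subrr.
(* Scaled so that its pairing with [xel (s - s')] is exactly the generator attached to (j, k), on
   which the chosen weight is nonzero. *)
pose u := yel i (c' (delta_mx 0 k) / (s - s') i).
have uA : (u : G) \in yz_set by apply: yel_yz.
have : l (h (enum_rank (j, k))) (beta t (xel (s - s')) u) = 0.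
  have : l (h (enum_rank (j, k))) (u + beta t (xel s) u) =
         l (h (enum_rank (j, k))) (u + beta t (xel s') u) by rewrite -lw // -lw'.
  rewrite !lD ?beta_yz // => /addrI e.
  apply: (addIr (l (h (enum_rank (j, k))) (beta t (xel s') u))).
  by rewrite -lD ?beta_yz // xelB subrK e add0r.
rewrite beta_xel_yel mulrC divfK // tij => l_gen0.
by have := h_neq0 (enum_rank (j, k)); rewrite mxE /gen enum_rankK l_gen0 eqxx.
Qed.
End LowerBound.
End HeisenbergFaithful.

(** * Faithful dimension and the Lie ring attached to the polynomial *)

Lemma m_faithful_heis (R : realType) (I J : finType) (t : I -> J)
    (F : finFieldType) (p f : nat) :
  prime p -> #|F| = (p ^ f)%N ->
  m_faithful R [set: heis_group F t]
  = (f * \sum_j (p ^ f) ^ #|[pred i | t i == j]|)%N.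
Proof.
move=> p_prime oF; have [z prim_z] := prim_root_exists R[i] p_prime.
have [c c_add c_bij] := Fp_coordinates p_prime oF.
rewrite -(card_schrodinger_idx t oF) /m_faithful.
case: ex_minnP => m /asboolP[rG rG_faithful] m_min.
apply/eqP; rewrite eqn_leq.
rewrite (faithful_bound p_prime oF prim_z c_add c_bij rG_faithful) andbT.
by apply/m_min/asboolP; apply: (schrodinger_repr_exists t p_prime oF prim_z c_add c_bij).
Qed.

Lemma heis_lie3 (I J : finType) (t : I -> J) (x y w : heis_lie t) :
  lie x (lie y w) = 0.
Proof. exact: hbracket3. Qed.

Lemma heis_fg (I J : finType) (t : I -> J) : fg_zmod (heis_lie t).
Proof.
exists [seq hbasis t k | k : hidx I J] => x.
have spanN (M : zmodType) (S : M -> Prop) (y : M) : addspan S y -> addspan S (- y).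
  by move=> Sy; rewrite -sub0r; apply: addspanB => //; apply: addspan0.
have spanD (M : zmodType) (S : M -> Prop) (y w : M) :
    addspan S y -> addspan S w -> addspan S (y + w).
  by move=> Sy Sw; rewrite -[w]opprK; apply: addspanB => //; apply: spanN.
rewrite (hbasis_decomp x).
elim/big_ind: _ => [|y w|k _]; [exact: addspan0|exact: spanD|].
have Sk : addspan (fun y => y \in [seq hbasis t k | k : hidx I J]) (hbasis t k).
  by apply: addspan_in; apply: image_f.
have SM m : addspan (fun y => y \in [seq hbasis t k | k : hidx I J]) (hbasis t k *+ m).
  by elim: m => [|m IH]; rewrite ?mulr0n ?mulrS; [exact: addspan0|exact: spanD].
case: ((x : {ffun hidx I J -> int}) k) => m; first by rewrite -pmulrn.
by rewrite NegzE mulrNz -pmulrn; apply: spanN.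
Qed.

Theorem corollary2p12 (R : realType) (g : {poly int}) (g_neq0 : g != 0)
    (g_ge0 : forall i : nat, 0 <= g`_i) :
  exists L : lieType,
    [/\ lie_nilpotent L, fg_zmod L &
        forall (p f : nat) (Fq : finFieldType),
          prime p -> ((size g).-1 + 2 <= p)%N -> (1 <= f)%N ->
          #|Fq| = (p ^ f)%N ->
          exists gT : finGroupType,
            is_exp (tensor L Fq) p gT /\
            (m_faithful R [set: gT])%:Z = f%:Z * g.[(p ^ f)%:Z] ].
Proof.
(* J has one element for each monomial T^d, repeated g_d times; the fibre of [t] over it has d
   elements, so the summand has rank 2 d + 1. *)
pose J : finType := {i : 'I_(size g) & 'I_(absz g`_i)}.
pose I : finType := {j : J & 'I_(tag j)}.
pose t : I -> J := tag.
exists (heis_lie t); split.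
- by exists 2 => x; apply: (lcs_class2 (@heis_lie3 _ _ t) (n := 0)).
- exact: heis_fg.
move=> p f Fq p_prime p_big f_gt0 oF; exists (heis_group Fq t); split.
  apply: (heis_is_exp t p_prime oF).
  (* If p = 2 then g is constant, all d are 0, and I is empty. *)
  have [p2|p2] := ltnP 2 p; [by left|right].
  have sz : (size g <= 1)%N.
    by have := leq_trans p_big p2; case: (size g) => [|[|s]] //; rewrite addn2.
  apply: eq_card0 => -[[i k] [a ai]]; exfalso.
  by have := leq_trans (ltn_ord i) sz; move: ai => /=; case: (i : nat).
rewrite (m_faithful_heis R t p_prime oF) PoszM; congr (_ * _).
rewrite horner_coef.
have -> : (\sum_j (p ^ f) ^ #|[pred i | t i == j]|)%N =
    (\sum_(j : J) (p ^ f) ^ tag j)%N.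
  apply: eq_bigr => j _; congr (_ ^ _)%N.
  rewrite -[RHS]card_ord; have tB := tag_with_bij (fun j : J => 'I_(tag j)) j.
  by rewrite (bij_eq_card tB) card_sig; apply: eq_card => i; rewrite !inE.
(* Grouping J by degree gives the sum of |g_d| q^d, and the coefficients are non-negative. *)
rewrite -(sig_big_dep predT (fun _ _ => true)
  (fun (i : 'I_(size g)) (_ : 'I_(absz (g`_i)%R)) => (p ^ f) ^ i)%N) /=.
rewrite -[LHS]natz natr_sum; apply: eq_bigr => i _.
rewrite sum_nat_const card_ord natrM natrX !natz; congr (_ * _).
by rewrite gez0_abs.
Qed.
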